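(* Let $\mathcal{S}=\{S_d:\mathcal{H}_d\to\mathcal{G}_d\}_{d\in\mathbb{N}}$ be a sequence of compact linear operators between Hilbert spaces, with eigenvalues $\lambda_{d,1}\ge\lambda_{d,2}\ge\cdots\ge 0$ of $S_d^*S_d$. Fix an error criterion, ABS or NOR, and let $\mathrm{CRI}_d=1$ for ABS and $\mathrm{CRI}_d=\lambda_{d,1}$ for NOR. Let $s,t>0$. Then $\mathcal{S}$ is EXP-$(s,t)$-WT-ABS/NOR (for the chosen criterion) iff $$\mu(c,s,t):=\sup_{d\in\mathbb{N}}\ \sigma(c,d,s)\,\exp(-c\,d^{t})<\infty\qquad\text{for all } c>0,$$ where $$\sigma(c,d,s):=\sum_{j=1}^\infty\exp\left(-c\left[1+\ln\left(2\max\left(1,\frac{\mathrm{CRI}_d}{\lambda_{d,j}}\right)\right)\right]^s\right).$$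
   Context: Setting. $\mathbb{N}=\{1,2,\dots\}$, $\mathbb{N}_0=\mathbb{N}\cup\{0\}$. For each $d\in\mathbb{N}$, $\mathcal{H}_d$ and $\mathcal{G}_d$ are Hilbert spaces and $S_d:\mathcal{H}_d\to\mathcal{G}_d$ is a compact linear operator; $\mathcal{S}=\{S_d\}_{d\in\mathbb{N}}$. The operator $W_d=S_d^*S_d$ is compact, self-adjoint and positive semi-definite; $\lambda_{d,1}\ge\lambda_{d,2}\ge\cdots$ denote its eigenvalues in non-increasing order, counted with multiplicity (the positive ones are listed; if there are only finitely many, the sequence is continued by zeros). For the criterion NOR it is assumed that $S_d\neq0$, i.e. $\lambda_{d,1}=\|S_d\|^2>0$. Convention: if $\lambda_{d,j}=0$, then $\mathrm{CRI}_d/\lambda_{d,j}=\infty$, $\ln\infty=\infty$, and $\exp(-\infty)=0$ (such $j$ contribute $0$ to the sum). Information complexity. An algorithm $A_{d,n}:\mathcal{H}_d\to\mathcal{G}_d$ has $A_{d,0}=0$, and for $n\ge1$ has the form $A_{d,n}(f)=\phi_n(L_1(f),\dots,L_n(f))$ with an arbitrary map $\phi_n:\mathbb{C}^n\to\mathcal{G}_d$ and continuous linear functionals $L_j$ on $\mathcal{H}_d$, possibly chosen adaptively ($L_j$ may depend on $L_1(f),\dots,L_{j-1}(f)$). Its worst case error is $e(A_{d,n})=\sup_{\|f\|_{\mathcal{H}_d}\le1}\|S_d(f)-A_{d,n}(f)\|_{\mathcal{G}_d}$, and $e(n,S_d)=\inf_{A_{d,n}}e(A_{d,n})$. For $\varepsilon>0$,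 $n_{\mathrm{ABS}}(\varepsilon,S_d)=\min\{n\in\mathbb{N}_0: e(n,S_d)\le\varepsilon\}$ (absolute error criterion, ABS) and $n_{\mathrm{NOR}}(\varepsilon,S_d)=\min\{n\in\mathbb{N}_0: e(n,S_d)\le\varepsilon\|S_d\|\}$ (normalized error criterion, NOR). It is a known fact that $n_{\mathrm{ABS}}(\varepsilon,S_d)=\min\{n\in\mathbb{N}_0:\lambda_{d,n+1}\le\varepsilon^2\}$ and $n_{\mathrm{NOR}}(\varepsilon,S_d)=\min\{n\in\mathbb{N}_0:\lambda_{d,n+1}\le\varepsilon^2\lambda_{d,1}\}$; these formulas may be taken as the definition. Tractability notion (for ABS or NOR). EXP-$(s,t)$-WT-ABS/NOR ($(s,t)$-weak tractability, exponential case), for $s,t>0$: $$\lim_{d+\varepsilon^{-1}\to\infty}\frac{\ln\max(1,n_{\mathrm{ABS}/\mathrm{NOR}}(\varepsilon,S_d))}{d^{t}+(1+\ln\max(1,\varepsilon^{-1}))^{s}}=0,$$ i.e. for every $\delta>0$ there is $K$ such that the quotient is at most $\delta$ for all $d\in\mathbb{N}$ and $\varepsilon>0$ with $d+\varepsilon^{-1}\ge K$. *)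

(* Defs.v *)
From HB Require Import structures.
From mathcomp Require Import all_boot all_order all_algebra.
From mathcomp Require Import complex.
From mathcomp Require Import all_classical all_reals all_analysis.
Import Order.TTheory GRing.Theory Num.Theory.
Import numFieldNormedType.Exports.

Set Implicit Arguments.
Unset Strict Implicit.
Unset Printing Implicit Defensive.

Local Open Scope classical_set_scope.
Local Open Scope card_scope.
Local Open Scope complex_scope.
Local Open Scope ring_scope.

(** Complex Hilbert spaces: Banach spaces whose norm comes from an inner
    product (linear in its first argument). The norm of a normed module over
    [R[i]] takes its values in [R[i]]. *)
Record hilbert (R : realType) := Hilbert {
  hilbert_sort :> completeNormedModType R[i];
  hdot : {dot hilbert_sort for Num.conj};
  hdotE : forall x : hilbert_sort, `|x| ^+ 2 = hdot x x }.

Section operators.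
Context {R : realType}.

Definition compact_operator (H G : hilbert R) (S : H -> G) : Prop :=
  forall A : set H, bounded_set A -> precompact (S @` A).

Definition is_adjoint (H G : hilbert R) (S : H -> G) (T : G -> H) : Prop :=
  forall (f : H) (g : G), hdot G (S f) g = hdot H f (T g).

Definition eigen_space (H : hilbert R) (W : H -> H) (x : R) : set H :=
  [set f | W f = x%:C *: f].

Definition has_dim (H : hilbert R) (E : set H) (n : nat) : Prop :=
  exists b : 'I_n -> H,
    (forall c : 'I_n -> R[i], \sum_i c i *: b i = 0 -> forall i, c i = 0) /\
    E = [set \sum_i c i *: b i | c in [set: 'I_n -> R[i]]].

(** [lam j] is the eigenvalue $\lambda_{j+1}$ of [W]: indices start at [0].
    Each [x > 0] occurs in [lam] as often as its multiplicity as an eigenvalue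
    of [W] (never if it is not an eigenvalue). Since [lam] is nonincreasing, the
    value [0] occurs only after all the positive eigenvalues, if these are
    finitely many. *)
Definition eigenvalue_sequence (H : hilbert R) (W : H -> H) (lam : nat -> R) :
    Prop :=
  [/\ forall j, 0 <= lam j,
      forall i j, (i <= j)%N -> lam j <= lam i &
      forall x : R, 0 < x -> exists n : nat,
        [set j | lam j = x] #= `I_n /\ has_dim (eigen_space W x) n].

End operators.

Inductive criterion := ABS | NOR.

Section tractability.
Context {R : realType}.
Variables (cri : criterion) (lam : nat -> nat -> R).

Definition CRI (d : nat) : R :=
  match cri with ABS => 1 | NOR => lam d 0%N end.

(** For a compact operator the minimal number of information operations with
    worst case error at most $\varepsilon\sqrt{\mathrm{CRI}_d}$ is
    $\min\{n \ge 0 : \lambda_{d,n+1} \le \varepsilon^2 \mathrm{CRI}_d\}$. The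
    minimum exists for [eps > 0] as $\lambda_{d,n} \to 0$, so the default value
    of [xget] plays no role. *)
Definition info_complexity (eps : R) (d : nat) : nat :=
  xget 0%N [set n | lam d n <= eps ^+ 2 * CRI d /\
                    forall m, lam d m <= eps ^+ 2 * CRI d -> (n <= m)%N].

Definition exp_wt (s t : R) : Prop :=
  forall delta : R, 0 < delta -> exists K : R,
    forall (d : nat) (eps : R), (0 < d)%N -> 0 < eps -> K <= d%:R + eps^-1 ->
      ln (Num.max 1 (info_complexity eps d)%:R) /
        (d%:R `^ t + (1 + ln (Num.max 1 eps^-1)) `^ s) <= delta.

(** The convention $\exp(-\infty) = 0$ applies to zero eigenvalues. *)
Definition sigma_term (c : R) (d : nat) (s : R) (j : nat) : R :=
  if lam d j == 0 then 0
  else expR (- (c * (1 + ln (2 * Num.max 1 (CRI d / lam d j))) `^ s)).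

Definition sigma (c : R) (d : nat) (s : R) : \bar R :=
  (\sum_(0 <= j <oo) (sigma_term c d s j)%:E)%E.

Definition mu (c s t : R) : \bar R :=
  ereal_sup [set (sigma c d s * (expR (- (c * d%:R `^ t)))%:E)%E
            | d in [set d : nat | (0 < d)%N]].

End tractability.

(* Main.v *)
(** For eps > 0 let n(eps, d) count the j with lambda_{d,j} > eps^2 CRI_d. If
    lambda_{d,j} > 0, choosing eps just below the threshold at which j is counted
    gives j <= n(eps, d), so weak tractability with delta = c / 2 bounds the j-th
    term of sigma(c, d, s) by a constant times exp (c d^t) / j^2. Conversely the
    first n(eps, d) terms of sigma(c, d, s) are all at least
    exp (- c 2^s (1 + ln max (1, 1/eps))^s), so ln n(eps, d) is at most
    ln mu + c d^t + c 2^s (1 + ln max (1, 1/eps))^s; let c tend to 0.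
    The operators enter only through lambda_{d,j} -> 0, which makes n(eps, d)
    finite. *)
Require Import Defs.
From HB Require Import structures.
From mathcomp Require Import all_boot all_order all_algebra.
From mathcomp Require Import complex.
From mathcomp Require Import all_classical all_reals all_analysis.
From mathcomp Require Import ring lra.
Import Order.TTheory GRing.Theory Num.Theory.
Import numFieldNormedType.Exports.
Local Open Scope ring_scope.

(** * Compactness forces the eigenvalues to zero *)

Section compact_operator_eigenvalues.
Set Implicit Arguments.
Unset Strict Implicit.
Local Open Scope classical_set_scope.
Local Open Scope complex_scope.
Context {R : realType}.

Lemma conjC_real (x : R) : Num.conj (x%:C) = x%:C.
Proof. by apply/CrealP/complex_realP; exists x. Qed.

Lemma hdot_conj (H : hilbert R) (f g : H) :
  hdot H f g = Num.conj (hdot H g f).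
Proof. by rewrite [LHS]hermC expr0 mul1r. Qed.

Lemma hdotBB (H : hilbert R) (f g : H) :
  hdot H (f - g) (f - g) =
  (hdot H f f - hdot H f g) - (hdot H g f - hdot H g g).
Proof. by rewrite linearBl [X in X - _]linearBr [X in _ - X]linearBr. Qed.

(** The level set of [lam j] contains [j], so the multiplicity is positive and a basis vector of the
    eigenspace can be normalized. *)
Lemma unit_eigenvector (H : hilbert R) (W : H -> H) (lam : nat -> R) (j : nat) :
  eigenvalue_sequence W lam -> 0 < lam j ->
  exists f : H, `|f| = 1 /\ W f = (lam j)%:C *: f.
Proof.
move=> [_ _ mult] lj_gt0; have [n [card_n [b [b_free b_span]]]] := mult _ lj_gt0.
case: n => [|n] in card_n b b_free b_span *.
  have : [set k | lam k = lam j] j by [].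
  by move: card_n; rewrite II0 card_eq0 => /eqP ->.
pose e (i : 'I_n.+1) : R[i] := (i == ord0)%:R.
have b_neq0 : b ord0 != 0.
  apply/eqP => b0; have /(_ ord0) : forall i, e i = 0.
    apply: b_free; rewrite (bigD1 ord0)//= b0 scaler0 add0r big1// => i /negPf.
    by rewrite /e => ->; rewrite scale0r.
  by rewrite /e eqxx => /eqP; rewrite oner_eq0.
exists (`|b ord0|^-1 *: b ord0); split.
  by rewrite normrZ normfV normr_id mulVf// normr_eq0.
suff : eigen_space W (lam j) (`|b ord0|^-1 *: b ord0) by [].
rewrite b_span; exists (fun i => `|b ord0|^-1 * e i) => //.
rewrite (bigD1 ord0)//= /e eqxx mulr1 big1 ?addr0// => i /negPf ->.
by rewrite mulr0 scale0r.
Qed.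

Section separation.
Variables (H G : hilbert R) (S : {linear H -> G}) (T : G -> H).
Hypothesis ST : is_adjoint S T.

Lemma dot_image_eigen (f g : H) (y : R) :
  T (S g) = y%:C *: g -> hdot G (S f) (S g) = y%:C * hdot H f g.
Proof. by move=> Wg; rewrite ST Wg linearZr_LR /= conjC_real. Qed.

(** Computing the inner product of the images from either side gives (x - y) <f, g> = 0. So f and g
    are orthogonal, hence so are their images, whose squared norms x and y add up. *)
Lemma dist_image_eigen (f g : H) (x y : R) :
  x != y -> `|f| = 1 -> `|g| = 1 ->
  T (S f) = x%:C *: f -> T (S g) = y%:C *: g ->
  `|S f - S g| ^+ 2 = (x + y)%:C.
Proof.
move=> xy f1 g1 Wf Wg.
have ff : hdot H f f = 1 by rewrite -hdotE f1 expr1n.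
have gg : hdot H g g = 1 by rewrite -hdotE g1 expr1n.
have fg : hdot H f g = 0.
  have E : y%:C * hdot H f g = x%:C * hdot H f g.
    rewrite -(dot_image_eigen f Wg) hdot_conj (dot_image_eigen g Wf).
    by rewrite rmorphM /= conjC_real -hdot_conj.
  apply/eqP; move/eqP: E; rewrite -subr_eq0 -mulrBl mulf_eq0 subr_eq0.
  by rewrite (inj_eq (@complexI _)) eq_sym (negPf xy).
have gf : hdot H g f = 0 by rewrite hdot_conj fg conjC0.
rewrite hdotE hdotBB !(dot_image_eigen _ Wf) !(dot_image_eigen _ Wg).
rewrite ff gg fg gf !mulr0 !mulr1 subr0 sub0r opprK.
by rewrite -rmorphD.
Qed.

End separation.

(* Unit eigenvectors of S^*S for distinct eigenvalues x, y have images at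
   distance sqrt (x + y), so eigenvalues bounded away from 0 would give a
   sequence in the image of the unit ball without cluster point. *)
Lemma eigenvalue_sequence_small (H G : hilbert R) (S : {linear H -> G})
    (T : G -> H) (lam : nat -> R) :
  compact_operator S -> is_adjoint S T ->
  eigenvalue_sequence (fun f => T (S f)) lam ->
  forall e : R, 0 < e -> exists j, lam j <= e.
Proof.
move=> S_cpt ST eig e e_gt0; apply: contrapT => /forallNP lam_big.
have {}lam_big j : e < lam j by rewrite ltNge; apply/negP/lam_big.
have lam_gt0 j : 0 < lam j := lt_trans e_gt0 (lam_big j).
have [_ lam_dec mult] := eig.
have [g g_eig] := choice (fun j => @unit_eigenvector H _ lam j eig (lam_gt0 j)).
(* Finite multiplicity and monotonicity make the sequence leave each value for good, so late indices
   give a different eigenvalue. *)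
have lam_drop j : exists k, forall m, (k <= m)%N -> lam m != lam j.
  have [n [card_n _]] := mult _ (lam_gt0 j).
  have fin : finite_set [set k | lam k = lam j] by exists n.
  have [k lam_k] : exists k, (j <= k)%N /\ lam k <> lam j.
    apply: contrapT => /forallNP all_eq; apply: infinite_nat.
    have : finite_set (`I_j `|` [set k | lam k = lam j]).
      by rewrite finite_setU; split => //; exact: finite_II.
    congr finite_set; apply/seteqP; split => // k _ /=.
    have [kj|jk] := ltnP k j; first by left.
    by right; apply: contrapT => lk; exact: (all_eq k).
  exists k => m km; apply/eqP => lm; case: lam_k => jk; apply.
  by apply/le_anti; rewrite (lam_dec _ _ jk) -lm (lam_dec _ _ km).
pose A := range g.
have A_bnd : bounded_set A.
  exists 1; split; first exact: real1.
  by move=> M M1 _ [j _ <-] /=; rewrite (g_eig j).1 ltW.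
have := S_cpt _ A_bnd; rewrite precompactE => cpt.
have [|p [_ p_cl]] := cpt ((S \o g) @ \oo) _.
  by exists 0%N => // j _; apply: subset_closure; exists (g j) => //; exists j.
(* Two points within [r] of [p] are less than sqrt e apart, while two images have squared distance
   lam i + lam m > e. *)
pose r : R[i] := (Num.sqrt e / 2)%:C.
have r_gt0 : 0 < r by rewrite ltcR divr_gt0// sqrtr_gt0.
have far N : exists j, (N <= j)%N /\ ball p r (S (g j)).
  have [|_ [[j Nj <-] pj]] := p_cl [set S (g j) | j in [set j | (N <= j)%N]]
    (ball p r) _ (nbhsx_ballx _ _ r_gt0).
    by exists N => // j Nj; exists j.
  by exists j.
have [i [_ pi]] := far 0%N.
have [k kP] := lam_drop i.
have [m [km pm]] := far k.
have [gi Wi] := g_eig i; have [gm Wm] := g_eig m.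
have d2 := @dist_image_eigen _ _ _ _ ST _ _ _ _ (kP _ km) gm gi Wm Wi.
have : `|S (g m) - S (g i)| < r + r.
  by move: (ball_triangle (ball_sym pm) pi); rewrite -ball_normE.
have re : r + r = (Num.sqrt e)%:C by rewrite -rmorphD -splitr.
rewrite re -(@ltr_pXn2r _ 2)// ?nnegrE ?ler0c ?sqrtr_ge0//.
rewrite d2 -rmorphXn /= sqr_sqrtr ?ltW// ltcR.
by move: (lam_big i) (lam_big m) e_gt0; lra.
Qed.

End compact_operator_eigenvalues.

(** * Bounds between the information complexity and sigma for fixed d *)

Section complexity_and_sigma.
Local Open Scope classical_set_scope.
Context {R : realType}.
Variables (cri : criterion) (lam : nat -> nat -> R) (d : nat) (s t : R).
Set Implicit Arguments.
Unset Strict Implicit.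
Hypotheses (lam_ge0 : forall j, 0 <= lam d j)
  (lam_dec : forall i j, (i <= j)%N -> lam d j <= lam d i).
Hypotheses (s_gt0 : 0 < s).

Local Notation CRI := (CRI cri lam d).
Local Notation n_ eps := (info_complexity cri lam eps d).
Local Notation sigma_term c j := (sigma_term cri lam c d s j).

Lemma lt_info_complexity (eps : R) (j : nat) :
  (j < n_ eps)%N -> eps ^+ 2 * CRI < lam d j.
Proof.
(* If no index qualifies, the default is 0 and [j < 0] is absurd. *)
rewrite /info_complexity; case: xgetP => [n _ [_ n_min]|//] jn.
by rewrite ltNge; apply/negP => /n_min; rewrite leqNgt jn.
Qed.

(** The index [m] ensures that the minimum exists; monotonicity then keeps [j] below it. *)
Lemma info_complexity_gt (eps : R) (j m : nat) :
  lam d m <= eps ^+ 2 * CRI -> eps ^+ 2 * CRI < lam d j -> (j < n_ eps)%N.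
Proof.
move=> lam_m lam_j.
have ex : exists n, lam d n <= eps ^+ 2 * CRI by exists m.
have [|lam_n _] := @xgetPex _ 0%N [set n | lam d n <= eps ^+ 2 * CRI /\
    forall m, lam d m <= eps ^+ 2 * CRI -> (n <= m)%N].
  by exists (ex_minn ex); case: ex_minnP.
rewrite ltnNge; apply/negP => /lam_dec lam_nj.
by move: (le_lt_trans (le_trans lam_nj lam_n) lam_j); rewrite ltxx.
Qed.

Lemma CRI_ge0 : 0 <= CRI.
Proof. by rewrite /Defs.CRI; case: cri. Qed.

Lemma CRI_gt0 (j : nat) : 0 < lam d j -> 0 < CRI.
Proof.
by rewrite /Defs.CRI; case: cri => // /lt_le_trans; apply; exact: lam_dec.
Qed.

Lemma sigma_term_ge0 (c : R) (j : nat) : 0 <= sigma_term c j.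
Proof. by rewrite /Defs.sigma_term; case: ifP => // _; exact: expR_ge0. Qed.

Lemma ler_powR_pos (x y : R) : 0 <= x -> x <= y -> x `^ s <= y `^ s.
Proof.
move=> x0 xy; apply: ge0_ler_powR; rewrite ?nnegrE ?(ltW s_gt0)//.
exact: le_trans xy.
Qed.

(* The precision eps = 1 / max (sqrt (2 x_j)) K, with
   x_j = max 1 (CRI / lambda_j), satisfies eps^2 CRI < lambda_j, so that the
   complexity at eps exceeds j; taking K into the maximum puts every term within
   the range where the weak tractability bound holds. *)
Lemma sigma_term_le (c K : R) (j : nat) :
  (forall e : R, 0 < e -> exists m, lam d m <= e) -> 0 < c -> 1 <= K ->
  (forall eps : R, 0 < eps -> K <= d%:R + eps^-1 ->
     ln (Num.max 1 (n_ eps)%:R) /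
       (d%:R `^ t + (1 + ln (Num.max 1 eps^-1)) `^ s) <= c / 2) ->
  sigma_term c j <=
    expR (c * (1 + ln K) `^ s) * expR (c * d%:R `^ t) * j.+1%:R^-1 ^+ 2.
Proof.
move=> lam_small c_gt0 K1 wt; rewrite /Defs.sigma_term.
have [_|lam_neq0] := eqVneq (lam d j) 0.
  by rewrite !mulr_ge0 ?expR_ge0 ?exprn_ge0 ?invr_ge0.
have lam_j : 0 < lam d j by rewrite lt0r lam_neq0 lam_ge0.
set x := Num.max 1 _.
have x1 : 1 <= x by rewrite le_max lexx.
have CRI_le : CRI <= x * lam d j by rewrite -ler_pdivrMr// le_max lexx orbT.
pose q : R := Num.max (Num.sqrt (2 * x)) K.
have q1 : 1 <= q by rewrite le_max K1 orbT.
have q_gt0 : 0 < q by exact: lt_le_trans q1.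
have q2 : 2 * x <= q ^+ 2.
  have x20 : 0 <= 2 * x by lra.
  rewrite -[leLHS]sqr_sqrtr// ler_pXn2r ?nnegrE ?sqrtr_ge0 ?(ltW q_gt0)//.
  by rewrite le_max lexx.
(* The factor 2 in [q] makes this strict: CRI <= x lambda_j < 2 x lambda_j <= q^2 lambda_j. *)
have eps_lt : q^-1 ^+ 2 * CRI < lam d j.
  rewrite exprVn mulrC ltr_pdivrMr ?exprn_gt0//.
  apply: le_lt_trans CRI_le _; rewrite mulrC ltr_pM2l//; lra.
have [m lam_m] : exists m, lam d m <= q^-1 ^+ 2 * CRI.
  by apply: lam_small; rewrite mulr_gt0 ?exprn_gt0 ?invr_gt0// (CRI_gt0 lam_j).
have j_lt := info_complexity_gt lam_m eps_lt.
have := wt q^-1; rewrite invrK invr_gt0 => /(_ q_gt0).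
have Kq : K <= d%:R + q.
  by apply: (@le_trans _ _ q); rewrite ?lerDr ?ler0n// le_max lexx orbT.
have lnq : 0 <= ln q by rewrite ln_ge0.
have Z_gt0 : 0 < (1 + ln q) `^ s by rewrite powR_gt0//; lra.
have D_ge0 : 0 <= d%:R `^ t :> R by exact: powR_ge0.
move=> /(_ Kq); rewrite (max_r q1) ler_pdivrMr; last by lra.
have ln_j : ln j.+1%:R <= ln (Num.max 1 (n_ q^-1)%:R) :> R.
  rewrite ler_ln ?posrE ?ltr0n// ?lt_max ?ltr01//.
  by rewrite le_max ler_nat j_lt orbT.
move=> /(le_trans ln_j) {}ln_j.
(* Each entry of the maximum [q] is covered by one summand; sqrt (2 x) <= 2 x because the root is at
   least 1. *)
have Zq : (1 + ln q) `^ s <= (1 + ln (2 * x)) `^ s + (1 + ln K) `^ s.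
  have x2 : 1 <= 2 * x by lra.
  have [qK|Kq'] := leP (Num.sqrt (2 * x)) K.
    by rewrite /q max_r// lerDr powR_ge0.
  rewrite /q max_l ?(ltW Kq')// ler_wpDr ?powR_ge0//.
  have sq : 1 <= Num.sqrt (2 * x) by rewrite ltW// (le_lt_trans K1).
  apply: ler_powR_pos; first by rewrite addr_ge0// ln_ge0.
  rewrite lerD2l ler_ln ?posrE ?(lt_le_trans ltr01)//.
  by rewrite -[leRHS]sqr_sqrtr ?(le_trans ler01)// expr2 ler_peMl ?sqrtr_ge0.
rewrite -!expRD.
(* In exponents the claim follows from 2 ln (j + 1) <= c (d^t + (1 + ln q)^s), the doubled
   tractability bound: hence c / 2 and the summable square. *)
have -> : j.+1%:R^-1 = expR (- ln j.+1%:R) :> R.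
  by rewrite expRN lnK// posrE ltr0n.
rewrite -expRM_natl -expRD ler_expR.
have := ler_wpM2l (ltW c_gt0) Zq; rewrite mulrDr; lra.
Qed.

(** Telescoping with 1 / (n + 2)^2 <= 1 / (n + 1) - 1 / (n + 2); the subtracted remainder lets the
    induction close. *)
Lemma sum_inv_sqr_le (n : nat) :
  \sum_(0 <= j < n.+1) (j.+1%:R^-1 ^+ 2 : R) <= 2 - n.+1%:R^-1.
Proof.
elim: n => [|n IHn]; first by rewrite big_nat1 invr1; lra.
rewrite big_nat_recr//=; apply: le_trans (lerD IHn (lexx _)) _.
rewrite -subr_ge0.
have -> : 2 - n.+2%:R^-1 - (2 - n.+1%:R^-1 + n.+2%:R^-1 ^+ 2) =
    n.+2%:R^-1 ^+ 2 * n.+1%:R^-1 :> R.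
  rewrite -[n.+2%:R]natr1; move: (ltr0Sn R n); move: (n.+1%:R : R) => a a_gt0.
  by field; rewrite !gt_eqF//; lra.
by rewrite mulr_ge0 ?exprn_ge0 ?invr_ge0.
Qed.

Lemma sigma_le (c B : R) :
  (forall j, sigma_term c j <= B * j.+1%:R^-1 ^+ 2) ->
  (sigma cri lam c d s <= (B * 2)%:E)%E.
Proof.
move=> term_le; apply: lime_le.
  by apply: is_cvg_nneseries => j _ _; rewrite lee_fin sigma_term_ge0.
have B_ge0 : 0 <= B.
  apply: le_trans (sigma_term_ge0 c 0) _.
  by have := term_le 0%N; rewrite invr1 expr1n mulr1.
exists 1%N => //= -[//|n] _; rewrite sumEFin lee_fin.
apply: (@le_trans _ _ (B * \sum_(0 <= j < n.+1) (j.+1%:R^-1 ^+ 2 : R))).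
  by rewrite mulr_sumr ler_sum.
rewrite ler_wpM2l// (le_trans (sum_inv_sqr_le n))//.
by rewrite lerBlDr lerDl invr_ge0.
Qed.

Lemma ln_info_complexity_le (c M eps : R) :
  0 < c -> 1 <= M -> 0 < eps ->
  (sigma cri lam c d s * (expR (- (c * d%:R `^ t)))%:E <= M%:E)%E ->
  ln (Num.max 1 (n_ eps)%:R) <=
    ln M + c * d%:R `^ t + c * 2 `^ s * (1 + ln (Num.max 1 eps^-1)) `^ s.
Proof.
move=> c_gt0 M1 eps_gt0 sigma_le; set E := Num.max 1 eps^-1.
have E1 : 1 <= E by rewrite le_max lexx.
have lnE : 0 <= ln E by rewrite ln_ge0.
have term_ge j : (j < n_ eps)%N ->
    expR (- (c * 2 `^ s * (1 + ln E) `^ s)) <= sigma_term c j.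
  move=> /lt_info_complexity lam_j.
  have lam_gt0 : 0 < lam d j.
    by apply: le_lt_trans lam_j; rewrite mulr_ge0 ?CRI_ge0// exprn_ge0// ltW.
  rewrite /Defs.sigma_term gt_eqF// ler_expR lerN2 -mulrA ler_pM2l//.
  set x := Num.max 1 _; have x1 : 1 <= x by rewrite le_max lexx.
  (* [lam_j] says CRI / lambda_j < eps^-2, and E dominates both 1 and 1 / eps. *)
  have xE : x <= E ^+ 2.
    rewrite ge_max expr_ge1 ?(le_trans ler01)// E1 /=.
    rewrite ler_pdivrMr//.
    have : eps^-1 ^+ 2 * lam d j <= E ^+ 2 * lam d j.
      rewrite ler_pM2r// ler_pXn2r ?nnegrE ?invr_ge0 ?(ltW eps_gt0)//.
        by rewrite le_max lexx orbT.
      exact: le_trans E1.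
    apply: le_trans; rewrite exprVn mulrC ler_pdivlMr ?exprn_gt0//.
    by rewrite mulrC ltW.
  (* Together with x <= E^2 this gives 1 + ln (2 x) <= 2 (1 + ln E), the origin of the factor
     2^s. *)
  have ln2 : ln (2 : R) <= 1.
    rewrite -[leRHS](expRK 1) ler_ln ?posrE ?expR_gt0//.
    by rewrite -[2](natrD _ 1 1) expR_ge1Dx.
  have lnx : ln (2 * x) <= 1 + 2 * ln E.
    have E_gt0 : 0 < E by exact: lt_le_trans E1.
    have x_gt0 : 0 < x by exact: lt_le_trans x1.
    rewrite lnM ?posrE// lerD// mulr_natl -lnXn// ler_ln ?posrE// exprn_gt0//.
  have lnx0 : 0 <= ln (2 * x) by rewrite ln_ge0; lra.
  by rewrite -powRM; [apply: ler_powR_pos; lra|lra|lra].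
(* At complexity 0 the left side is ln 1 = 0, and M >= 1 makes the right side nonnegative. *)
have [n0|n_gt0] := posnP (n_ eps).
  rewrite n0 (max_l (ler01)) ln1 !addr_ge0 ?ln_ge0//.
    by rewrite mulr_ge0 ?powR_ge0 ?(ltW c_gt0).
  by rewrite !mulr_ge0 ?powR_ge0 ?(ltW c_gt0).
have sum_ge : (((n_ eps)%:R * expR (- (c * 2 `^ s * (1 + ln E) `^ s)))%:E <=
    sigma cri lam c d s)%E.
  apply: le_trans (nneseries_lim_ge (n_ eps) _); last first.
    by move=> j _ _; rewrite lee_fin sigma_term_ge0.
  rewrite sumEFin lee_fin big_mkord mulr_natl -[X in _ *+ X]card_ord -sumr_const.
  by apply: ler_sum => j _; exact: term_ge.
have {sum_ge sigma_le} : (n_ eps)%:R * expR (- (c * 2 `^ s * (1 + ln E) `^ s)) *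
    expR (- (c * d%:R `^ t)) <= M.
  rewrite -lee_fin; apply: le_trans sigma_le.
  by rewrite EFinM lee_wpmul2r// lee_fin expR_ge0.
rewrite (max_r (_ : 1 <= _)) ?ler1n// !expRN -mulrA -invfM.
rewrite ler_pdivrMr ?mulr_gt0 ?expR_gt0// -expRD => le_n.
have M_gt0 : 0 < M by exact: lt_le_trans M1.
have : ln (n_ eps)%:R <=
    ln (M * expR (c * 2 `^ s * (1 + ln E) `^ s + c * d%:R `^ t)).
  by rewrite ler_ln ?posrE ?ltr0n// mulr_gt0 ?expR_gt0.
rewrite lnM ?posrE ?expR_gt0// expRK; lra.
Qed.

End complexity_and_sigma.

(** * Choice of constants and the equivalence *)

(** Either d >= L^(1/t), or the rest of the sum forces 1 / eps > exp (L^(1/s)). This lets a constant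
    such as ln M be absorbed into the weight. *)
Lemma weight_large (R : realType) (s t L eps : R) (d : nat) :
  0 < s -> 0 < t -> 0 <= L -> 0 < eps ->
  2 * L `^ t^-1 + 2 * expR (L `^ s^-1) <= d%:R + eps^-1 ->
  L <= d%:R `^ t + (1 + ln (Num.max 1 eps^-1)) `^ s.
Proof.
move=> s_gt0 t_gt0 L0 eps_gt0 K_le.
have powRVK (r : R) : 0 < r -> (L `^ r^-1) `^ r = L.
  by move=> r_gt0; rewrite -powRrM mulVf ?gt_eqF// powRr1.
have eps1 : 0 <= ln (Num.max 1 eps^-1) by rewrite ln_ge0// le_max lexx.
have [d_ge|d_lt] := leP (L `^ t^-1) d%:R.
  apply: ler_wpDr; first exact: powR_ge0.
  by rewrite -[leLHS](powRVK t)//; apply: ler_powR_pos => //; exact: powR_ge0.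
apply: ler_wpDl; first exact: powR_ge0.
rewrite -[leLHS](powRVK s)//; apply: ler_powR_pos => //; first exact: powR_ge0.
apply: ler_wpDl => //; rewrite -[leLHS]expRK ler_ln ?posrE ?expR_gt0//.
  rewrite le_max; apply/orP; right.
  by have := expR_gt0 (L `^ s^-1); have := powR_ge0 L t^-1; lra.
by rewrite lt_max ltr01.
Qed.

Theorem theorem3 (R : realType) (H G : nat -> hilbert R)
    (S : forall d : nat, {linear H d -> G d})
    (S_compact : forall d : nat, (0 < d)%N -> compact_operator (S d))
    (Sadj : forall d : nat, G d -> H d)
    (S_adj : forall d : nat, (0 < d)%N -> is_adjoint (S d) (Sadj d))
    (lam : nat -> nat -> R)
    (lam_eig : forall d : nat, (0 < d)%N ->
       eigenvalue_sequence (fun f : H d => Sadj d (S d f)) (lam d))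
    (cri : criterion)
    (S_neq0 : cri = NOR -> forall d : nat, (0 < d)%N ->
       exists f : H d, S d f <> 0)
    (s t : R) (s_gt0 : 0 < s) (t_gt0 : 0 < t) :
  exp_wt cri lam s t <->
  forall c : R, 0 < c -> (mu cri lam c s t < +oo)%E.
Proof.
have lam_ge0 d : (0 < d)%N -> forall j, 0 <= lam d j.
  by move=> /lam_eig[].
have lam_dec d : (0 < d)%N -> forall i j, (i <= j)%N -> lam d j <= lam d i.
  by move=> /lam_eig[].
split=> [wt c c_gt0|mu_fin delta delta_gt0].
  have [K wtK] : exists K : R, forall (d : nat) (eps : R), (0 < d)%N -> 0 < eps ->
      K <= d%:R + eps^-1 -> ln (Num.max 1 (info_complexity cri lam eps d)%:R) /
        (d%:R `^ t + (1 + ln (Num.max 1 eps^-1)) `^ s) <= c / 2.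
    by apply: wt; rewrite divr_gt0.
  (* [sigma_term_le] asks for a threshold of at least 1; raising [K] keeps the bound valid. *)
  pose K1 := Num.max 1 K.
  have K1_ge1 : 1 <= K1 by rewrite le_max lexx.
  (* Uniform in d: the factor exp (- c d^t) in mu cancels the growth exp (c d^t) of sigma. *)
  apply: (@le_lt_trans _ _ (expR (c * (1 + ln K1) `^ s) * 2)%:E);
    last exact: ltry.
  apply: ge_ereal_sup => _ [d /= d_gt0 <-].
  have sig_le : (sigma cri lam c d s <=
      (expR (c * (1 + ln K1) `^ s) * expR (c * d%:R `^ t) * 2)%:E)%E.
    apply: sigma_le => j.
    apply: sigma_term_le => //; [exact: lam_ge0|exact: lam_dec| |].
      exact: eigenvalue_sequence_small (S_compact _ d_gt0) (S_adj _ d_gt0)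
        (lam_eig _ d_gt0).
    move=> eps eps_gt0 K_le; apply: wtK => //.
    by apply: le_trans K_le; rewrite le_max lexx orbT.
  apply: le_trans (lee_wpmul2r _ sig_le) _.
    by rewrite lee_fin expR_ge0.
  by rewrite -EFinM lee_fin expRN mulrAC mulfK ?gt_eqF ?expR_gt0//.
have two_s : 1 <= 2 `^ s :> R.
  by rewrite -[leLHS](powRr0 2) ler_powR ?ler1n// ltW.
have two_s_gt0 : 0 < 2 `^ s :> R by exact: lt_le_trans two_s.
(* Then c 2^s = delta / 2, and also c <= delta / 2 since 2^s >= 1. *)
pose c := delta / 2 / 2 `^ s.
have c_gt0 : 0 < c by rewrite !divr_gt0.
have [M [M1 mu_le]] : exists M : R, 1 <= M /\ (mu cri lam c s t <= M%:E)%E.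
  have := mu_fin c c_gt0; case: (mu _ _ _ _ _) => [r _| //|_].
    by exists (Num.max 1 r); rewrite lee_fin !le_max !lexx orbT.
  by exists 1; rewrite leNye.
(* Now ln M = (delta / 2) L costs at most half of delta times the weight; the two terms with c cost
   the other half. *)
pose L := 2 * ln M / delta.
have lnM0 : 0 <= ln M by rewrite ln_ge0.
have L0 : 0 <= L by rewrite divr_ge0 ?(ltW delta_gt0)// mulr_ge0.
exists (2 * L `^ t^-1 + 2 * expR (L `^ s^-1)) => d eps d_gt0 eps_gt0.
move=> /(@weight_large _ _ _ _ _ _ s_gt0 t_gt0 L0 eps_gt0).
have sig_le : (sigma cri lam c d s * (expR (- (c * d%:R `^ t)))%:E <= M%:E)%E.
  by apply: le_trans mu_le; apply: ereal_sup_ubound; exists d.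
have := ln_info_complexity_le (lam_ge0 _ d_gt0) s_gt0 c_gt0 M1 eps_gt0 sig_le.
have lnME : ln M = delta / 2 * L by rewrite /L; field; rewrite gt_eqF.
have c2 : c * 2 `^ s = delta / 2 by rewrite /c divfK// gt_eqF.
have D0 : 0 <= d%:R `^ t :> R by exact: powR_ge0.
have Z0 : 0 < (1 + ln (Num.max 1 eps^-1)) `^ s.
  by rewrite powR_gt0// ltr_pwDl// ln_ge0// le_max lexx.
have c_le : c * d%:R `^ t <= delta / 2 * d%:R `^ t.
  by rewrite ler_wpM2r// ler_pdivrMr// ler_peMr// divr_ge0// ltW.
rewrite c2 lnME => n_le L_le; rewrite ler_pdivrMr; last by lra.
have := ler_wpM2l (divr_ge0 (ltW delta_gt0) (ler0n R 2)) L_le.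
by rewrite mulrDr; lra.
Qed.
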